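(* In the setting described in the context, suppose the system starts from a recurrent state and $v_1$ follows an anti-threshold rule. Then one of the following holds: (i) $(c_t)$ is constant and the system has period $1$ or $2$; (ii) $(c_t)$ alternates and the system has period $2$; (iii) $(c_t)$ periodically repeats the sequence $+1,+1,-1,-1$ and the system has period $4$; (iv) $(c_t)$ periodically repeats $+1,+1,+1,-1,-1,-1$ and the system has period $6$; (v) $(c_t)$ periodically repeats $x,x,x,-x$ for some $x\in\{+1,-1\}$ and the system has period $4$; (vi) $(c_t)$ periodically repeats $x,x,x,-x,-x$ for some $x\in\{+1,-1\}$ and the system has period $5$ or $10$; (vii) $(c_t)$ periodically repeats $x,-x,-x$ for some $x\in\{+1,-1\}$ and the system has period $3$ or $6$; or (viii) $(c_t)$ periodically repeats $x,-x,-x,x,x,-x,-x,-x$ for some $x\in\{+1,-1\}$ and the system has period $8$. Moreover, if $G$ has no loops then one of (i)--(vi) holds.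
   Context: $G$ is a finite graph (loops allowed, no multiple edges) on vertex set $\{v_1,\dots,v_n\}$; $N_i$ is the neighbourhood of $v_i$ (including $v_i$ iff there is a loop at $v_i$). Each vertex holds an opinion in $\{+1,-1\}$; $U_t$ is the set of vertices with opinion $+1$ at time $t$. All vertices update simultaneously: $v_i\in U_{t+1}$ iff $N_i\cap U_t\in\mathcal S_i$, where for $i\ge2$, $\mathcal S_i=\{A\subseteq N_i:|A|\ge r_i\}$ (threshold rule, integer $r_i$), and $v_1$ follows an anti-threshold rule: $\mathcal S_1=\{A\subseteq N_1:|A|<r_1\}$ for some integer $r_1$. Starting from a recurrent state means $U_p=U_0$ for some $p\ge1$; the period of the system is the least such $p$. $c_t\in\{+1,-1\}$ denotes the opinion of $v_1$ at time $t$ (''repeats the sequence'' is read up to a shift of time). *)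

(* Defs.v *)
From mathcomp Require Import all_boot all_order all_algebra.

Set Implicit Arguments.
Unset Strict Implicit.
Unset Printing Implicit Defensive.

Import Order.TTheory GRing.Theory Num.Theory.
Local Open Scope ring_scope.

(* A finite graph is a symmetric relation [e] on a finType; a loop at [v] is
   [e v v].  Thresholds are arbitrary integers, possibly negative or larger
   than the degree.  A state is the set of vertices holding opinion +1. *)

Section Dynamics.

Variables (T : finType) (e : rel T) (r : T -> int) (v1 : T).

Definition nbhd (v : T) : {set T} := [set w | e v w].

Definition threshold_rule (v : T) : {set {set T}} :=
  [set A in powerset (nbhd v) | r v <= #|A|%:Z].

Definition anti_threshold_rule (v : T) : {set {set T}} :=
  [set A in powerset (nbhd v) | #|A|%:Z < r v].

Definition rule (v : T) : {set {set T}} :=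
  if v == v1 then anti_threshold_rule v else threshold_rule v.

Definition step (U : {set T}) : {set T} :=
  [set v | nbhd v :&: U \in rule v].

Definition state (U0 : {set T}) (t : nat) : {set T} := iter t step U0.

Definition opinion (U0 : {set T}) (v : T) (t : nat) : int :=
  if v \in state U0 t then 1 else -1.

Definition recurrent (U0 : {set T}) : Prop :=
  exists2 p : nat, (0 < p)%N & state U0 p = U0.

Definition has_period (U0 : {set T}) (p : nat) : Prop :=
  [/\ (0 < p)%N, state U0 p = U0
    & forall q : nat, (0 < q)%N -> state U0 q = U0 -> (p <= q)%N].

End Dynamics.

(* The offset [k] is the shift of time. *)
Definition repeats (c : nat -> int) (s : seq int) : Prop :=
  exists k : nat, forall t : nat, c t = s`_((t + k) %% size s).

Definition is_constant (c : nat -> int) : Prop := forall t : nat, c t = c 0%N.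

Definition alternates (c : nat -> int) : Prop := forall t : nat, c t.+1 = - c t.

Definition is_sign (x : int) : Prop := x = 1 \/ x = -1.

(* [c] is the opinion sequence of the anti-threshold vertex and [period p]
   says that the system has period [p]. *)
Section Cases.

Variables (c : nat -> int) (period : nat -> Prop).

Definition case_i : Prop := is_constant c /\ (period 1 \/ period 2).

Definition case_ii : Prop := alternates c /\ period 2.

Definition case_iii : Prop := repeats c [:: 1; 1; -1; -1] /\ period 4.

Definition case_iv : Prop := repeats c [:: 1; 1; 1; -1; -1; -1] /\ period 6.

Definition case_v : Prop :=
  (exists2 x, is_sign x & repeats c [:: x; x; x; - x]) /\ period 4.

Definition case_vi : Prop :=
  (exists2 x, is_sign x & repeats c [:: x; x; x; - x; - x])
  /\ (period 5 \/ period 10).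

Definition case_vii : Prop :=
  (exists2 x, is_sign x & repeats c [:: x; - x; - x])
  /\ (period 3 \/ period 6).

Definition case_viii : Prop :=
  (exists2 x, is_sign x & repeats c [:: x; - x; - x; x; x; - x; - x; - x])
  /\ period 8.

End Cases.

(* Main.v *)
Require Import Defs.
From mathcomp Require Import all_boot all_order all_algebra.
From mathcomp Require Import zify ring.

(* Let c(t) say whether v1 holds +1, let S(t) be the set of the other vertices
   holding +1, and d_v(t) the number of neighbours of v in S(t).

   Goles-Olivos energy with the contribution of v1 replaced by the average of
   its two possible values: along a periodic orbit this energy is monotone,
   hence constant, and all its increments vanish.  This gives, besides
     v in S(t+1) <-> r_v <= d_v(t) + [v ~ v1] c(t),
   the time-reversed bounds
     r_v <= d_v(t+1) -> v in S(t) -> r_v <= d_v(t+1) + [v ~ v1].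
   So if S(a) is included in S(b), then
     S(a+1) <= S(b+1) when c(a) <= c(b),
     S(a+1) <= S(b-1) when c(a) = 0,
     S(a-1) <= S(b+1) when c(b) = 1,
   while the anti-threshold rule reverses the order: c(b+1) <= c(a+1) when
   c(a) <= c(b).  Saturating these rules on finite windows refutes 24 factors
   of the word c, and a periodic word avoiding these factors is one of 13
   cyclic words.  On each of these the same rules compare S(a) with S(a+K) for
   some a and a small K; by periodicity they are equal. *)

Set Implicit Arguments.
Unset Strict Implicit.
Unset Printing Implicit Defensive.

(** * Words *)

Definition window (c : nat -> bool) (t n : nat) : seq bool :=
  mkseq (fun i => c (t + i)) n.

Definition cyclic_nth (p : seq bool) (t : nat) : bool :=
  nth false p (t %% size p).

Lemma size_window c t n : size (window c t n) = n.
Proof. exact: size_mkseq. Qed.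

Lemma nth_window c t n i : i < n -> nth false (window c t n) i = c (t + i).
Proof. exact: nth_mkseq. Qed.

Lemma window_cons c t n : window c t n.+1 = c t :: window c t.+1 n.
Proof.
rewrite /window /mkseq /= addn0; congr cons.
rewrite (iotaDl 1 0) -map_comp; apply: eq_map => i /=.
by rewrite addnA addn1.
Qed.

Lemma take_window c t m n : m <= n -> take m (window c t n) = window c t m.
Proof.
by move=> le_mn; rewrite /window /mkseq -map_take take_iota (minn_idPl le_mn).
Qed.

Lemma eq_window c d s t n :
  (forall i, c (s + i) = d (t + i)) -> window c s n = window d t n.
Proof. by move=> cd; apply: eq_map. Qed.

Lemma periodicM (X : Type) (f : nat -> X) P t k :
  (forall s, f (s + P) = f s) -> f (t + k * P) = f t.
Proof.
move=> per; elim: k => [|k IHk]; first by rewrite mul0n addn0.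
by rewrite mulSn addnCA addnC per.
Qed.

(** * Order rules and their saturation on a finite window *)

Section Rules.

Variables (loop : bool) (c : nat -> bool) (le : nat -> nat -> Prop).

(* [le a b] stands for the inclusion of S(a) in S(b).  With [loop := false],
   [rule_opinion] holds without comparing [c a] and [c b]: this is the case when
   v1 does not see its own opinion. *)
Record order_rules : Prop := MkOrderRules {
  rule_refl : forall a, le a a;
  rule_trans : forall b a d, le a b -> le b d -> le a d;
  rule_step : forall a b, c a ==> c b -> le a b -> le a.+1 b.+1;
  rule_fall : forall a b, ~~ c a -> le a b.+1 -> le a.+1 b;
  rule_rise : forall a b, c b -> le a.+1 b -> le a b.+1;
  rule_opinion : forall a b, le a b -> loop ==> (c a ==> c b) ->
    c b.+1 -> c a.+1;
  rule_anti : forall a b, le a b -> odd a = odd b -> c a -> ~~ c b ->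
    ~~ c a.+1 -> c b.+1 -> le b a }.

End Rules.

(** [rule_opinion] is absent: it yields no inclusion and only serves to detect contradictions in
    [refuted]. *)
Definition inferences (w : seq bool) (L : seq (nat * nat)) (a b : nat) :
    seq (nat * nat) :=
  let c := nth false w in
  (if c a ==> c b then [:: (a.+1, b.+1)] else [::]) ++
  (if ~~ c a && (0 < b) then [:: (a.+1, b.-1)] else [::]) ++
  (if c b && (0 < a) then [:: (a.-1, b.+1)] else [::]) ++
  (if [&& a.+1 < size w, b.+1 < size w, odd a == odd b,
          c a, ~~ c b, ~~ c a.+1 & c b.+1] then [:: (b, a)] else [::]) ++
  [seq (a, p.2) | p <- L & p.1 == b] ++ [seq (p.1, b) | p <- L & p.2 == a].

(** A worklist algorithm: running out of fuel or dropping pairs that leave the window loses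
    consequences, never soundness. *)
Fixpoint saturate (w : seq bool) (fuel : nat) (L q : seq (nat * nat)) :
    seq (nat * nat) :=
  if fuel is n.+1 then
    if q is (a, b) :: q' then
      if [|| (a, b) \in L, size w <= a | size w <= b] then saturate w n L q'
      else saturate w n ((a, b) :: L) (inferences w L a b ++ q')
    else L
  else L.

Definition rule_closure (fuel : nat) (w : seq bool) : seq (nat * nat) :=
  saturate w fuel [::] [seq (i, i) | i <- iota 0 (size w)].

Definition refuted (loop : bool) (fuel : nat) (w : seq bool) : bool :=
  let c := nth false w in
  has (fun p => [&& p.1.+1 < size w, p.2.+1 < size w,
                    loop ==> (c p.1 ==> c p.2), c p.2.+1 & ~~ c p.1.+1])
      (rule_closure fuel w).

Section ClosureSound.

Variables (loop : bool) (c : nat -> bool) (le : nat -> nat -> Prop).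
Hypothesis rules : order_rules loop c le.

Lemma saturate_sound t w fuel L q :
    (forall i, i < size w -> nth false w i = c (t + i)) ->
    {in L, forall p, le (t + p.1) (t + p.2)} ->
    {in q, forall p, le (t + p.1) (t + p.2)} ->
  {in saturate w fuel L q, forall p, le (t + p.1) (t + p.2)}.
Proof.
move=> wc; elim: fuel L q => //= n IHn L [//|[a b] q] Lok qok.
have q'ok : {in q, forall p, le (t + p.1) (t + p.2)}.
  by move=> p pq; apply: qok; rewrite inE pq orbT.
case: ifP => [_|/norP[_ /norP[]]]; first exact: IHn.
rewrite -!ltnNge => lta ltb.
have leab : le (t + a) (t + b) by apply: (qok (a, b)); rewrite inE eqxx.
apply: IHn => [p|p]; first by rewrite inE => /predU1P[->//|/Lok].
rewrite mem_cat => /orP[|/q'ok//].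
rewrite /inferences /= !mem_cat (wc a) // (wc b) //.
case/orP.
  case: ifP => // cab; rewrite inE => /eqP->; rewrite /= !addnS.
  exact: rule_step rules _ _ cab leab.
case/orP.
  case: ifP => // /andP[nca b0]; rewrite inE => /eqP->; rewrite /= !addnS.
  by apply: (rule_fall rules nca); rewrite -addnS prednK.
case/orP.
  case: ifP => // /andP[cb a0]; rewrite inE => /eqP->; rewrite /= !addnS.
  by apply: (rule_rise rules cb); rewrite -addnS prednK.
case/orP.
  case: ifP => // /and5P[lta1 ltb1 /eqP oab ca /and3P[ncb]].
  rewrite !wc // !addnS => nca1 cb1; rewrite inE => /eqP->.
  by apply: (rule_anti rules leab) => //; rewrite !oddD oab.
case/orP=> /mapP[[x y]]; rewrite mem_filter /= => /andP[/eqP E /Lok lexy] -> /=;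
  rewrite {}E in lexy.
  exact: rule_trans rules _ _ _ leab lexy.
exact: rule_trans rules _ _ _ lexy leab.
Qed.

Lemma rule_closure_sound fuel t w : window c t (size w) = w ->
  {in rule_closure fuel w, forall p, le (t + p.1) (t + p.2)}.
Proof.
move=> wE; apply: saturate_sound => [i lti|//|p].
  by rewrite -wE nth_window.
by case/mapP=> i _ ->; exact: rule_refl rules _.
Qed.

Lemma refuted_sound fuel t w : refuted loop fuel w -> window c t (size w) != w.
Proof.
move=> /hasP[[a b] /= abw /and5P[lta ltb lab cb nca]]; apply/eqP => wE.
have nthw i : i < size w -> nth false w i = c (t + i).
  by move=> lti; rewrite -wE nth_window.
have leab : le (t + a) (t + b) := rule_closure_sound wE abw.
move: lab cb nca; rewrite !nthw ?(ltnW lta) ?(ltnW ltb) // !addnS => lab cb.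
by rewrite (rule_opinion rules leab).
Qed.

End ClosureSound.

(** * Periodic words avoiding factors *)

Definition avoids (F : seq (seq bool)) (c : nat -> bool) : Prop :=
  forall t f, f \in F -> window c t (size f) != f.

(** Testing prefixes is enough, since the tails already avoid [F]. *)
Fixpoint avoiding (F : seq (seq bool)) (n : nat) : seq (seq bool) :=
  if n is n'.+1 then
    let ws := avoiding F n' in
    [seq w <- map (cons true) ws ++ map (cons false) ws
       | ~~ has (fun f => prefix f w) F]
  else [:: [::]].

Lemma avoidingP F c t n : avoids F c -> window c t n \in avoiding F n.
Proof.
move=> Fc; elim: n t => [|n IHn] t //=.
rewrite mem_filter mem_cat; apply/andP; split.
  apply/hasPn => f fF; rewrite prefixE; apply: contra (Fc t f fF) => /eqP wf.
  have lef : size f <= n.+1.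
    by rewrite -{1}wf size_take_min size_window geq_minr.
  by rewrite -{2}wf take_window.
rewrite window_cons; case: (c t); last rewrite orbC.
  by rewrite map_f.
by rewrite map_f.
Qed.

Definition rotations (p : seq bool) (m : nat) : seq (seq bool) :=
  [seq window (cyclic_nth p) k m | k <- iota 0 (size p)].

(* Once [c] reads [m] letters of the cyclic word [p], it reads [p] forever; the
   lookahead [n] rules out the excursions that cannot be continued. *)
Definition absorbing (F : seq (seq bool)) (n : nat) (p : seq bool) (m : nat) :
    bool :=
  all (fun w =>
    all (fun k => (take m w == window (cyclic_nth p) k m) ==>
                  (take m (behead w) == window (cyclic_nth p) k.+1 m))
        (iota 0 (size p)))
    (avoiding F n).

(* By periodicity, a word either follows [p] or never reads [m] letters of [p];
   in the latter case the rotations of [p] become forbidden in turn. *)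
Fixpoint exhausts (F : seq (seq bool)) (ps : seq (seq bool * (nat * nat)))
    (n : nat) : bool :=
  if ps is (p, (m, l)) :: ps' then
    [&& 0 < size p, 0 < m < l, absorbing F l p m
      & exhausts (rotations p m ++ F) ps' n]
  else avoiding F n == [::].

Lemma cyclic_nthM p t k : cyclic_nth p (t + k * size p) = cyclic_nth p t.
Proof. by rewrite /cyclic_nth addnC modnMDl. Qed.

(** As [size p] divides [K], v1 has equal opinions at times [K] apart; an inclusion in either
    direction then forces a return after [K] steps. *)
Definition returns (fuel : nat) (p : seq bool) (n K : nat) : bool :=
  [&& 0 < K, 0 < size p, size p %| K &
      has (fun a => let L := rule_closure fuel (window (cyclic_nth p) 0 n) in
                    ((a, a + K) \in L) || ((a + K, a) \in L)) (iota 0 n)].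

(** Every period of the system is a period of the opinion of v1, hence of the cyclic word. *)
Definition candidate_periods (p : seq bool) (K : nat) : seq nat :=
  [seq q <- iota 1 K | window (cyclic_nth p) q (size p)
                       == window (cyclic_nth p) 0 (size p)].

Section Periodic.

Variables (c : nat -> bool) (P : nat).
Hypotheses (P_gt0 : 0 < P) (cP : forall t, c (t + P) = c t).

Definition follows (p : seq bool) : Prop :=
  exists k, forall t, c t = cyclic_nth p (t + k).

Lemma window_cyclic_mod p k m :
  window (cyclic_nth p) (k %% size p) m = window (cyclic_nth p) k m.
Proof.
by apply: eq_window => i; rewrite /cyclic_nth modnDml.
Qed.

Lemma absorbing_follows F n p m t k :
    avoids F c -> 0 < size p -> 0 < m < n -> absorbing F n p m ->
    window c t m = window (cyclic_nth p) k m ->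
  follows p.
Proof.
case: n => [|n] Fc p0 /andP[m0 //] mn /allP abs tk.
have next s j : window c s m = window (cyclic_nth p) j m ->
    window c s.+1 m = window (cyclic_nth p) j.+1 m.
  rewrite -(window_cyclic_mod p j) => sj.
  have /(allP (abs _ (avoidingP s n.+1 Fc))) : j %% size p \in iota 0 (size p).
    by rewrite mem_iota ltn_mod.
  rewrite take_window 1?ltnW // sj eqxx window_cons implyTb take_window //.
  move=> /eqP->; rewrite -window_cyclic_mod -addn1 modnDml addn1.
  exact: window_cyclic_mod.
have all_next j : window c (t + j) m = window (cyclic_nth p) (k + j) m.
  by elim: j => [|j IHj]; rewrite ?addn0 // !addnS; apply: next.
(* Agreement from time [t] on covers all times: time [s] is read at [s + t * P], where [c] has the
   same value. *)
exists (k + (t * P - t)) => s.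
have tP : t <= t * P by rewrite leq_pmulr.
have := congr1 (head false) (all_next (s + (t * P - t))).
rewrite -{1 2}(prednK m0) !window_cons /=.
have -> : t + (s + (t * P - t)) = s + t * P by lia.
by rewrite (periodicM _ _ cP) addnCA => ->.
Qed.

Lemma exhausts_follows F ps n : avoids F c -> exhausts F ps n ->
  exists2 p, p \in unzip1 ps & follows p.
Proof.
elim: ps F => [|[p [m l]] ps IHps] F Fc /=.
  by move=> /eqP E; have := avoidingP 0 n Fc; rewrite E.
case/and4P=> p0 m0 abs ex.
(* By periodicity only the times below [P] need to be searched. *)
case: (boolP (has (fun t => has (fun w => window c t m == w) (rotations p m))
   (iota 0 P))) => [/hasP[t _ /hasP[w /mapP[k _ ->] /eqP tk]]|none].
  by exists p; [rewrite inE eqxx | exact: absorbing_follows Fc p0 m0 abs tk].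
have Fc' : avoids (rotations p m ++ F) c.
  move=> t f; rewrite mem_cat => /orP[fp|/Fc//].
  have sf : size f = m by case/mapP: fp => k _ ->; rewrite size_window.
  have tP : t %% P \in iota 0 P by rewrite mem_iota ltn_mod.
  rewrite sf; have := hasPn (hasPn none _ tP) _ fp.
  congr (_ != _); apply: eq_window => i.
  by rewrite {2}(divn_eq t P) -addnA (addnC (_ * P)) (periodicM _ _ cP).
have [q qps cq] := IHps _ Fc' ex.
by exists q => //; rewrite inE qps orbT.
Qed.

End Periodic.

Definition word (s : seq nat) : seq bool := map (eqn 1) s.

(* Up to complementation, these are the factors that the rules refute and that
   are needed to isolate the cyclic words below. *)
Definition forbidden : seq (seq bool) :=
  let F := map word
   [:: [:: 0; 1; 0; 1; 1]; [:: 0; 0; 1; 1; 1; 1]; [:: 0; 1; 0; 0; 0; 0];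
       [:: 0; 0; 1; 1; 0; 1]; [:: 0; 1; 0; 0; 1; 1; 1];
       [:: 0; 1; 0; 0; 1; 0; 0; 0]; [:: 0; 0; 0; 1; 1; 1; 0; 1];
       [:: 0; 0; 1; 1; 0; 0; 1; 1; 1]; [:: 0; 1; 0; 0; 1; 0; 0; 1; 1];
       [:: 0; 0; 0; 1; 1; 1; 0; 0; 1]; [:: 0; 1; 1; 0; 0; 0; 1; 0; 0; 0];
       [:: 0; 0; 1; 1; 1; 0; 0; 1; 1; 1; 0; 1]] in
  F ++ map (map negb) F.

(* Each word comes with the arguments [m] and [n] of [absorbing].  The order
   matters: a word is absorbing only once the words to which it can escape
   have been excluded. *)
Definition patterns : seq (seq bool * (nat * nat)) :=
  [:: (word [:: 1; 0], (4, 5));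
      (word [:: 1; 1; 0; 0], (8, 9));
      (word [:: 1; 1; 1; 0; 0; 0], (8, 9));
      (word [:: 1; 0; 0], (8, 9));
      (word [:: 0; 1; 1], (8, 9));
      (word [:: 1; 1; 1; 0; 0], (11, 13));
      (word [:: 0; 1; 1; 0; 0; 1; 1; 1], (9, 12));
      (word [:: 1; 1; 1; 0], (5, 11));
      (word [:: 1], (3, 9));
      (word [:: 0; 0; 0; 1; 1], (11, 13));
      (word [:: 1; 0; 0; 1; 1; 0; 0; 0], (9, 12));
      (word [:: 0; 0; 0; 1], (5, 11));
      (word [:: 0], (2, 8))].

Lemma forbidden_refuted : all (refuted true 300) forbidden.
Proof. by vm_compute. Qed.

Lemma patterns_exhaust : exhausts forbidden patterns 7.
Proof. by vm_compute. Qed.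

Import Order.TTheory GRing.Theory Num.Theory.
Local Open Scope ring_scope.

(** * The dynamics *)

Section Dynamics.

Variables (T : finType) (e : rel T) (r : T -> int) (v1 : T) (U0 : {set T}).
Hypothesis e_sym : symmetric e.

Local Notation U := (state e r v1 U0).

(* [crowd] and [dissent] are the S and c of the introduction. *)
Definition crowd (t : nat) : {set T} := U t :\ v1.

Definition plus_degree (v : T) (t : nat) : nat := #|nbhd e v :&: crowd t|.

Definition dissent (t : nat) : bool := v1 \in U t.

Lemma card_nbhd_state v t :
  #|nbhd e v :&: U t| = (plus_degree v t + (e v v1 && dissent t))%N.
Proof.
rewrite (cardsD1 v1) !inE addnC /plus_degree /crowd.
congr (#|pred_of_set _| + _)%N.
by apply/setP => w; rewrite !inE andbCA.
Qed.

Lemma state_threshold v t : v != v1 ->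
  (v \in U t.+1) = (r v <= (plus_degree v t + (e v v1 && dissent t))%N%:Z).
Proof.
move=> nv; rewrite -card_nbhd_state [state _ _ _ _ _]iterS inE /rule (negPf nv).
by rewrite !inE subsetIl.
Qed.

Lemma dissentS t :
  dissent t.+1 = ((plus_degree v1 t + (e v1 v1 && dissent t))%N%:Z < r v1).
Proof.
rewrite -card_nbhd_state /dissent [state _ _ _ _ _]iterS inE /rule eqxx.
by rewrite !inE subsetIl.
Qed.

(** * Energy along a periodic orbit *)

Lemma plus_degree_sum v t :
  plus_degree v t = (\sum_(w in crowd t) e v w)%N.
Proof.
rewrite /plus_degree -sum1_card big_mkcond [RHS]big_mkcond /=.
by apply: eq_bigr => w _; rewrite in_setI inE; case: (e v w); case: (w \in _).
Qed.

(** Both sides count the ordered adjacent pairs between the two crowds. *)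
Lemma plus_degree_exchange s t :
  (\sum_(v in crowd s) plus_degree v t = \sum_(v in crowd t) plus_degree v s)%N.
Proof.
under eq_bigr do rewrite plus_degree_sum.
rewrite exchange_big /=; apply: eq_bigr => w _; rewrite plus_degree_sum.
by apply: eq_bigr => v _; rewrite e_sym.
Qed.

(* The term [(e v v1)%:Z] stands for [2 * (1/2) * e v v1]: the opinion of v1 is
   replaced by 1/2.  The summand 1 shifts the threshold off the integers. *)
Definition field (v : T) : int := 1 - 2 * r v + (e v v1)%:Z.

Definition energy (t : nat) : int :=
  \sum_(v in crowd t.+1) (2 * (plus_degree v t)%:Z + field v)
  + \sum_(v in crowd t) field v.

Definition drift (v : T) (t : nat) : int :=
  ((v \in U t.+2)%:Z - (v \in U t)%:Z)
  * (2 * (plus_degree v t.+1)%:Z + field v).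

(** Double counting moves the degrees in [energy t] to time [t.+1], where [energy t.+1] also takes
    them; only the memberships at [t] and [t.+2] then differ. *)
Lemma energy_diff t :
  energy t.+1 = energy t + \sum_(v | v != v1) drift v t.
Proof.
have crowdE (F : T -> int) s :
    \sum_(v in crowd s) F v = \sum_(v | v != v1) (v \in U s)%:Z * F v.
  rewrite big_mkcond [RHS]big_mkcond; apply: eq_bigr => v _.
  by rewrite !inE; case: (v == v1) => //=; case: (v \in U s);
    rewrite ?mul1r ?mul0r.
have -> : energy t = \sum_(v in crowd t) (2 * (plus_degree v t.+1)%:Z + field v)
    + \sum_(v in crowd t.+1) field v.
  have sumZ s u : \sum_(v in crowd s) 2 * (plus_degree v u)%:Z
      = 2 * (\sum_(v in crowd s) plus_degree v u)%N%:Z.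
    by rewrite -mulr_sumr (big_morph Posz PoszD (erefl _)).
  rewrite /energy; move: field => f.
  by rewrite !big_split /= !sumZ plus_degree_exchange addrAC.
rewrite /energy /drift !crowdE; under [X in _ = _ + X]eq_bigr do rewrite mulrBl.
by rewrite sumrB; ring.
Qed.

(** The threshold rule makes the second factor nonnegative if [v] is in [U t.+2] and nonpositive
    otherwise. It vanishes only for a neighbour of v1 with [plus_degree v t.+1] equal to
    [r v - 1]. *)
Lemma drift_ge0 v t : v != v1 -> 0 <= drift v t.
Proof.
move=> nv; rewrite /drift (state_threshold t.+1 nv) /field.
by case: (v \in U t); case: (e v v1) => /=; case: (dissent t.+1) => /=;
  case: lerP => /=; rewrite ?addn0; lia.
Qed.

Variable P : nat.
Hypotheses (P_gt0 : (0 < P)%N) (UP : U P = U0).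

Lemma state_periodic t : U (t + P)%N = U t.
Proof. by rewrite [LHS]iterD -[iter P _ _]/(U P) UP. Qed.

Lemma drift_eq0 v t : v != v1 -> drift v t = 0.
Proof.
move=> nv.
have mono s n : energy s <= energy (s + n)%N.
  elim: n => [|n IHn]; first by rewrite addn0.
  rewrite addnS energy_diff (le_trans IHn) // lerDl.
  by apply: sumr_ge0 => w nw; apply: drift_ge0.
have perE s : energy (s + P)%N = energy s.
  have crowdP u : crowd (u + P)%N = crowd u by rewrite /crowd state_periodic.
  by rewrite /energy /plus_degree -addSn !crowdP.
(* From [t.+1], [P.-1] further steps lead to [t + P], where the energy is back to [energy t]. *)
have := mono t.+1 P.-1; rewrite addSnnS prednK // perE energy_diff.
have drift0 w : w != v1 -> 0 <= drift w t by exact: drift_ge0.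
rewrite gerDl => sum_le0.
have /eqP : \sum_(w | w != v1) drift w t == 0.
  by rewrite eq_le sum_le0 sumr_ge0.
by move/(psumr_eq0P drift0); apply.
Qed.

(** The bound puts [v] in [U t.+2] and makes the second factor of [drift] positive, so zero drift
    puts [v] in [U t]. *)
Lemma plus_degree_locked v t :
  v != v1 -> r v <= (plus_degree v t.+1)%:Z -> v \in U t.
Proof.
move=> nv rb; have := drift_eq0 t nv.
rewrite /drift (state_threshold _ nv) /field.
case: (v \in U t) => //; have -> : r v <= (plus_degree v t.+1
    + (e v v1 && dissent t.+1))%N%:Z by lia.
by case: (e v v1) => /=; lia.
Qed.

(** Otherwise [v] is outside [U t.+2] and the second factor of [drift] is negative, so the drift
    would be positive. *)
Lemma state_supported v t : v != v1 -> v \in U t ->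
  r v <= (plus_degree v t.+1 + e v v1)%N%:Z.
Proof.
move=> nv vU; have := drift_eq0 t nv.
rewrite /drift (state_threshold _ nv) /field vU.
by case: (e v v1) => /=; case: (dissent t.+1) => /=; case: lerP => /=;
  rewrite ?addn0; lia.
Qed.

(** Away from v1 the two time-reversed bounds coincide with the forward rule, whence period 2. *)
Lemma state_parity v s k : v != v1 -> ~~ e v v1 ->
  (v \in U (s + k.*2)%N) = (v \in U s).
Proof.
move=> nv /negPf ev; elim: k => [|k IHk]; first by rewrite addn0.
rewrite doubleS !addnS -IHk (state_threshold _ nv) ev /= addn0.
apply/idP/idP => [|/(state_supported nv)]; first exact: plus_degree_locked.
by rewrite ev addn0.
Qed.

(** * Inclusions between crowds *)

Definition below (a b : nat) : Prop := crowd a \subset crowd b.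

Lemma mem_below a b :
  (forall v, v != v1 -> v \in U a -> v \in U b) -> below a b.
Proof.
by move=> ab; apply/subsetP => v; rewrite !inE => /andP[nv /(ab v nv)->];
  rewrite nv.
Qed.

Lemma plus_degree_below v a b :
  below a b -> (plus_degree v a <= plus_degree v b)%N.
Proof. by move=> ab; apply/subset_leq_card/setIS. Qed.

(** [rule_fall] applies the forward rule at [a], then [plus_degree_locked] at [b]; [rule_rise]
    applies [state_supported] at [a], then the forward rule at [b]. *)
Lemma dynamics_order_rules (loop : bool) : e v1 v1 ==> loop ->
  order_rules loop dissent below.
Proof.
move=> eloop; split=> [a|b a d|a b ca|a b nca|a b cb|a b|a b].
- exact: subxx.
- exact: subset_trans.
- move=> ab; apply: mem_below => v nv; rewrite !(state_threshold _ nv).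
  have := plus_degree_below v ab; move: ca.
  by case: (dissent a); case: (dissent b); case: (e v v1) => //=; lia.
- move=> ab; apply: mem_below => v nv.
  rewrite (state_threshold _ nv) (negPf nca) andbF addn0 => rb.
  by apply: plus_degree_locked nv _; have := plus_degree_below v ab; lia.
- move=> ab; apply: mem_below => v nv /(state_supported nv).
  rewrite (state_threshold _ nv) cb andbT.
  by have := plus_degree_below v ab; lia.
- move=> ab cab; rewrite !dissentS; have := plus_degree_below v1 ab.
  by move: cab eloop; case: loop; case: (e v1 v1) => //=;
    case: (dissent a); case: (dissent b) => //=; lia.
(* The loop at v1 adds at most 1, so S(a) and S(b) have the same number of
   neighbours of v1, hence the same ones; all other vertices have period 2. *)
move=> ab oab ca ncb; rewrite !dissentS ca (negPf ncb) andbT andbF addn0.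
rewrite -leNgt => ra rb.
have sab : plus_degree v1 a = plus_degree v1 b.
  by have := plus_degree_below v1 ab; move: ra rb; case: (e v1 v1); lia.
apply: mem_below => v nv; case: (boolP (e v v1)) => [ev|nev].
  have /subset_cardP/(_ (setIS _ ab)) := sab.
  by move=> /(_ v); rewrite !inE e_sym ev nv /= => ->.
rewrite -(odd_double_half a) -(odd_double_half b) !state_parity //.
by rewrite oab.
Qed.

Let rules : order_rules true dissent below.
Proof. by apply: dynamics_order_rules; rewrite implybT. Qed.

(** * Return times and the period of the system *)

Lemma dissent_periodic t : dissent (t + P)%N = dissent t.
Proof. by rewrite /dissent state_periodic. Qed.

Lemma crowd_periodicM t k : crowd (t + k * P)%N = crowd t.
Proof. by apply: periodicM => s; rewrite /crowd state_periodic. Qed.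

Lemma state_eq a b : crowd a = crowd b -> dissent a = dissent b -> U a = U b.
Proof.
move=> cab dab; apply/setP => v.
case: (eqVneq v v1) => [->|nv]; first exact: dab.
by have /setP/(_ v) := cab; rewrite !inE nv.
Qed.

Lemma below_shift a b j : (forall i, dissent (a + i)%N = dissent (b + i)%N) ->
  below a b -> below (a + j)%N (b + j)%N.
Proof.
move=> dab ab; elim: j => [|j IHj]; first by rewrite !addn0.
by rewrite !addnS; apply: (rule_step rules) IHj; rewrite dab implybb.
Qed.

(** Shifting the inclusion by multiples of [K] gives a chain from S(0) through S(K) up to S(KP),
    which is S(0) again; so all its terms are equal. *)
Lemma state_return K s : (forall t, dissent (t + K)%N = dissent t) ->
  below s (s + K)%N -> U K = U0.
Proof.
move=> dK sK; have dKM i n := periodicM i n dK.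
have below0K : below 0 K.
  have sP : (s <= s * P)%N by rewrite leq_pmulr.
  have := @below_shift s (s + K) (s * P - s) _ sK.
  have -> : (s + K + (s * P - s) = K + s * P)%N by lia.
  rewrite subnKC // /below crowd_periodicM -[(s * P)%N]add0n crowd_periodicM.
  by apply=> i; rewrite addnAC dK.
have below_multiple n : below 0 (n * K).
  elim: n => [|n IHn]; first exact: subxx.
  apply: (rule_trans rules) below0K _.
  have := @below_shift 0 (n * K) K _ IHn; rewrite add0n mulSn addnC; apply.
  by move=> i; rewrite add0n (addnC (n * K)%N) dKM.
have KP : (K + P.-1 * K = 0 + K * P)%N by rewrite -mulSn prednK // mulnC.
have belowK0 : below K 0.
  have := @below_shift 0 (P.-1 * K) K _ (below_multiple _).
  rewrite add0n addnC KP /below crowd_periodicM; apply => i.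
  by rewrite add0n addnC dKM.
apply: (@state_eq K 0); last by rewrite -(dK 0%N) add0n.
by apply/eqP; rewrite eqEsubset; apply/andP; split.
Qed.

Lemma returns_state fuel p n K :
  follows dissent p -> returns fuel p n K -> U K = U0.
Proof.
move=> [k dp] /and4P[K0 p0 /dvdnP[m Km]].
have dK t : dissent (t + K)%N = dissent t.
  by rewrite !dp addnAC Km cyclic_nthM.
case/hasP=> a _ /= aK.
set w := window (cyclic_nth p) 0 n in aK.
(* This [t] is [-k] modulo [size p], so the window at [t] starts at the first letter of [p]. *)
set t := (k * size p - k)%N.
have tk : (t + k = 0 + k * size p)%N by rewrite subnK // leq_pmulr.
have wE : window dissent t (size w) = w.
  rewrite size_window; apply: eq_window => i.
  by rewrite dp addnAC tk addnAC cyclic_nthM.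
case/orP: aK => [aK|Ka].
  have := rule_closure_sound rules wE aK; rewrite /= addnA; exact: state_return.
have := rule_closure_sound rules wE Ka; rewrite /= addnA => tKa.
(* The reverse inclusion goes forward by [P.-1 * K] steps modulo the period; one more [K] completes
   [K * P]. *)
have UPK : U (P.-1 * K) = U0.
  apply: (@state_return _ (t + a + K)%N) => [i|].
    by rewrite (periodicM _ _ dK).
  have -> : (t + a + K + P.-1 * K = t + a + K * P)%N.
    by rewrite -addnA -mulSn prednK // mulnC.
  by rewrite /below crowd_periodicM.
have -> : U K = U (K + P.-1 * K)%N.
  by rewrite [RHS]iterD -[iter _ _ U0]/(U _) UPK.
rewrite -mulSn prednK // mulnC -[(K * P)%N]add0n.
by rewrite (periodicM _ _ state_periodic).
Qed.

Lemma returns_has_period fuel p n K :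
    follows dissent p -> returns fuel p n K ->
  exists2 q, q \in candidate_periods p K & has_period e r v1 U0 q.
Proof.
move=> dp ret; have UK := returns_state dp ret.
have /and4P[K0 p0 _ _] := ret; case: dp => k dp.
have exq : exists q, (0 < q)%N && (U q == U0) by exists K; rewrite K0 UK eqxx.
case: (ex_minnP exq) => q /andP[q0 /eqP Uq] qmin; exists q; last first.
  by split=> // q' q'0 /eqP Uq'; apply: qmin; rewrite q'0.
rewrite mem_filter mem_iota q0 add1n ltnS qmin ?K0 ?UK ?eqxx // !andbT.
apply/eqP; apply: eq_window => i.
have tk : (k * size p - k + k = k * size p)%N by rewrite subnK // leq_pmulr.
have dq t : dissent (t + q)%N = dissent t.
  by rewrite /dissent [state _ _ _ _ _]iterD -[iter q _ _]/(U q) Uq.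
have := dq (i + (k * size p - k))%N; rewrite !dp.
have -> : (i + (k * size p - k) + q + k = q + i + k * size p)%N by lia.
have -> : (i + (k * size p - k) + k = i + k * size p)%N by lia.
by rewrite !cyclic_nthM.
Qed.

Lemma dissent_pattern : exists2 p, p \in unzip1 patterns & follows dissent p.
Proof.
apply: (exhausts_follows P_gt0 dissent_periodic _ patterns_exhaust).
by move=> t f /(allP forbidden_refuted) /(refuted_sound rules t).
Qed.

(** Without a loop at v1 [rule_opinion] is unconditional, which refutes further words. *)
Lemma loopless_not_follows fuel p n : ~~ e v1 v1 -> (0 < size p)%N ->
  refuted false fuel (window (cyclic_nth p) 0 n) -> ~ follows dissent p.
Proof.
move=> noloop p0 ref [k dp].
have rulesF : order_rules false dissent below.
  by apply: dynamics_order_rules; rewrite implybF.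
have := refuted_sound rulesF (k * size p - k) ref.
rewrite size_window => /eqP[].
apply: eq_window => i.
by rewrite dp addnAC subnK ?leq_pmulr // addnC cyclic_nthM.
Qed.

Lemma follows_repeats p : (0 < size p)%N -> follows dissent p ->
  repeats (opinion e r v1 U0 v1) [seq if b then 1 else -1 | b <- p].
Proof.
move=> p0 [k dp]; exists k => t; rewrite size_map (nth_map false) ?ltn_mod //.
by rewrite -[nth _ _ _]/(cyclic_nth p (t + k)) -dp.
Qed.

End Dynamics.

(** * From cyclic words to the eight cases *)

Lemma repeats_constant (c : nat -> int) x : repeats c [:: x] -> is_constant c.
Proof. by move=> [k ck] t; rewrite !ck /= !modn1. Qed.

Lemma repeats_alternates (c : nat -> int) :
  repeats c [:: 1; -1] -> alternates c.
Proof. by move=> [k ck] t; rewrite !ck /= !modn2 addSn /=; case: odd. Qed.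

Theorem theorem10 (T : finType) (e : rel T) (e_sym : symmetric e)
    (r : T -> int) (v1 : T) (U0 : {set T})
    (U0_recurrent : recurrent e r v1 U0) :
  let c := opinion e r v1 U0 v1 in
  let period := has_period e r v1 U0 in
  (case_i c period \/ case_ii c period \/ case_iii c period \/
   case_iv c period \/ case_v c period \/ case_vi c period \/
   case_vii c period \/ case_viii c period)
  /\ ((forall v : T, ~~ e v v) ->
      case_i c period \/ case_ii c period \/ case_iii c period \/
      case_iv c period \/ case_v c period \/ case_vi c period).
Proof.
move=> c period.
(* Proving that cases (vii) and (viii) come with a loop settles both claims at once. *)
suff: (case_i c period \/ case_ii c period \/ case_iii c period \/
       case_iv c period \/ case_v c period \/ case_vi c period) \/
      (case_vii c period \/ case_viii c period) /\ ~ forall v, ~~ e v v.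
  by tauto.
have [P P_gt0 UP] := U0_recurrent.
have [p p_in dp] := dissent_pattern e_sym P_gt0 UP.
have rep p0 := follows_repeats p0 dp.
(* Thirteen letters leave room for [a] and [a + K] with [K] up to 10, the largest value below. *)
have per K s : returns 1000 p 13 K && (candidate_periods p K == s) ->
    exists2 q, q \in s & period q.
  move=> /andP[ret /eqP <-].
  by have [q qK perq] := returns_has_period e_sym P_gt0 UP dp ret; exists q.
have noloop (p0 : (0 < size p)%N) :
    refuted false 1000 (window (cyclic_nth p) 0 10) ->
    ~ forall v : T, ~~ e v v.
  move=> ref nl.
  by case: (loopless_not_follows e_sym P_gt0 UP (nl v1) p0 ref dp).
have sign1 : is_sign 1 by left.
have signN1 : is_sign (-1) by right.
move: p_in; rewrite !inE.
(* The thirteen goals come in the order of [patterns]. *)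
do ![case/orP] => /eqP Ep; move: rep per noloop; rewrite {}Ep /=;
  move=> /(_ isT) rep per /(_ isT) noloop.
- have [|q /[!inE] /eqP->] := per 2 [:: 2]%N; first by vm_compute.
  by move=> ?; left; right; left; split=> //; exact: repeats_alternates.
- have [|q /[!inE] /eqP->] := per 4 [:: 4]%N; first by vm_compute.
  by move=> ?; left; do 2!right; left; split.
- have [|q /[!inE] /eqP->] := per 6 [:: 6]%N; first by vm_compute.
  by move=> ?; left; do 3!right; left; split.
- have [|q /[!inE] q36 perq] := per 6 [:: 3; 6]%N; first by vm_compute.
  right; split; last by apply: noloop; vm_compute.
  left; split; first by exists 1.
  by case/orP: q36 perq => /eqP->; [left | right].
- have [|q /[!inE] q36 perq] := per 6 [:: 3; 6]%N; first by vm_compute.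
  right; split; last by apply: noloop; vm_compute.
  left; split; first by exists (-1).
  by case/orP: q36 perq => /eqP->; [left | right].
- have [|q /[!inE] q36 perq] := per 10 [:: 5; 10]%N; first by vm_compute.
  left; do 5!right; split; first by exists 1.
  by case/orP: q36 perq => /eqP->; [left | right].
- have [|q /[!inE] /eqP->] := per 8 [:: 8]%N; first by vm_compute.
  right; split; last by apply: noloop; vm_compute.
  by right; split=> //; exists (-1).
- have [|q /[!inE] /eqP->] := per 4 [:: 4]%N; first by vm_compute.
  by left; do 4!right; left; split=> //; exists 1.
- have [|q /[!inE] q12 perq] := per 2 [:: 1; 2]%N; first by vm_compute.
  do 2!left; split; first exact: repeats_constant rep.
  by case/orP: q12 perq => /eqP->; [left | right].
- have [|q /[!inE] q36 perq] := per 10 [:: 5; 10]%N; first by vm_compute.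
  left; do 5!right; split; first by exists (-1).
  by case/orP: q36 perq => /eqP->; [left | right].
- have [|q /[!inE] /eqP->] := per 8 [:: 8]%N; first by vm_compute.
  right; split; last by apply: noloop; vm_compute.
  by right; split=> //; exists 1.
- have [|q /[!inE] /eqP->] := per 4 [:: 4]%N; first by vm_compute.
  by left; do 4!right; left; split=> //; exists (-1).
have [|q /[!inE] q12 perq] := per 2 [:: 1; 2]%N; first by vm_compute.
do 2!left; split; first exact: repeats_constant rep.
by case/orP: q12 perq => /eqP->; [left | right].
Qed.
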